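(* Let $R$ be a ring, let $M$ be an abelian endoregular right $R$-module, and let $N$ be an $M$-generated submodule of $M$. Then $N$ is an abelian endoregular module.
   Context: Rings are associative with identity and modules are unitary right modules. A ring $S$ is von Neumann regular if for every $s\in S$ there is $x\in S$ with $sxs=s$; it is abelian if every idempotent of $S$ is central. A module $M$ is abelian endoregular if $\operatorname{End}_R(M)$ is an abelian von Neumann regular ring. A module $N$ is $M$-generated if there is an epimorphism $M^{(\mathcal I)}\to N$ for some index set $\mathcal I$, where $M^{(\mathcal I)}$ is the direct sum of $|\mathcal I|$ copies of $M$. *)

(* Defs.v *)
From HB Require Import structures.
From mathcomp Require Import all_boot all_algebra.
From mathcomp Require Import boolp classical_sets functions cardinality.

Set Implicit Arguments.
Unset Strict Implicit.
Unset Printing Implicit Defensive.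

Import GRing.Theory.
Local Open Scope ring_scope.
Local Open Scope classical_set_scope.

(* [pzRingType] and not [nzRingType]: the endomorphism ring of the zero module
   is the zero ring. *)
Definition von_neumann_regular (S : pzRingType) : Prop :=
  forall s : S, exists x : S, s * x * s = s.

Definition abelian_ring (S : pzRingType) : Prop :=
  forall e : S, e * e = e -> forall s : S, e * s = s * e.

(* Modules of the library are left modules; a right R-module is a left module
   over the converse ring, so that [a *: m] stands for m a. *)
Notation rmodType R := (lmodType R^c).

Lemma linear_ext (R : pzRingType) (U V : lmodType R) (f g : {linear U -> V}) :
  f =1 g -> f = g.
Proof.
case: f g => [f [[f1] [f2]]] [g [[g1] [g2]]] /= /funext fg.
by case: _ / fg in g1 g2 *; rewrite (Prop_irrelevance f1 g1) (Prop_irrelevance f2 g2).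
Qed.

Section EndomorphismRing.
Variables (R : pzRingType) (M : rmodType R).

Definition endo : Type := {linear M -> M}.

HB.instance Definition _ := gen_eqMixin endo.
HB.instance Definition _ := gen_choiceMixin endo.

Implicit Types f g h : endo.

Definition endo_zero : endo := (\0 : M -> M).
Definition endo_opp f : endo := (\- f).
Definition endo_add f g : endo := (f \+ g).
Definition endo_one : endo := (idfun : M -> M).
(* Endomorphisms of a right module act on the left: (f * g) m = f (g m). *)
Definition endo_mul f g : endo := (f \o g).

Fact endo_addA : associative endo_add.
Proof. by move=> f g h; apply: linear_ext => x /=; rewrite addrA. Qed.
Fact endo_addC : commutative endo_add.
Proof. by move=> f g; apply: linear_ext => x /=; rewrite addrC. Qed.
Fact endo_add0 : left_id endo_zero endo_add.
Proof. by move=> f; apply: linear_ext => x /=; rewrite add0r. Qed.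
Fact endo_addN : left_inverse endo_zero endo_opp endo_add.
Proof. by move=> f; apply: linear_ext => x /=; rewrite addNr. Qed.

HB.instance Definition _ :=
  GRing.isZmodule.Build endo endo_addA endo_addC endo_add0 endo_addN.

Fact endo_mulA : associative endo_mul.
Proof. by move=> f g h; apply: linear_ext. Qed.
Fact endo_mul1l : left_id endo_one endo_mul.
Proof. by move=> f; apply: linear_ext. Qed.
Fact endo_mul1r : right_id endo_one endo_mul.
Proof. by move=> f; apply: linear_ext. Qed.
Fact endo_mulDl : left_distributive endo_mul +%R.
Proof. by move=> f g h; apply: linear_ext. Qed.
Fact endo_mulDr : right_distributive endo_mul +%R.
Proof. by move=> f g h; apply: linear_ext => x /=; rewrite raddfD. Qed.

HB.instance Definition _ := GRing.Zmodule_isPzRing.Build endo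
  endo_mulA endo_mul1l endo_mul1r endo_mulDl endo_mulDr.

End EndomorphismRing.

Section DirectSum.
Variables (R : pzRingType) (I : Type) (M : rmodType R).

Definition finitely_supported : {pred I -> M} :=
  fun u => `[< finite_set [set i | u i != 0] >].

Fact finitely_supported_closed : subsemimod_closed finitely_supported.
Proof.
split; first split.
- by apply/asboolP; apply: sub_finite_set (finite_set0 I) => i /=; rewrite eqxx.
- move=> u v /asboolP fu /asboolP fv; apply/asboolP.
  have fuv : finite_set ([set i | u i != 0] `|` [set i | v i != 0]).
    by rewrite finite_setU.
  apply: sub_finite_set fuv => i /=.
  by have [ui0|//] := eqVneq (u i) 0; [rewrite /GRing.add /= ui0 add0r; right | left].
- move=> a u /asboolP fu; apply/asboolP; apply: sub_finite_set fu => i /=.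
  by apply: contra => /eqP ui0; rewrite /GRing.scale /= ui0 scaler0.
Qed.

Definition direct_sum : Type := {u : I -> M | finitely_supported u}.

HB.instance Definition _ := SubChoice.on direct_sum.
HB.instance Definition _ := GRing.SubChoice_isSubLmodule.Build R^c (I -> M)
  finitely_supported direct_sum finitely_supported_closed.

End DirectSum.

Definition abelian_endoregular (R : pzRingType) (M : rmodType R) : Prop :=
  abelian_ring (endo M) /\ von_neumann_regular (endo M).

Definition generated_by (R : pzRingType) (M N : rmodType R) : Prop :=
  exists (I : Type) (f : {linear direct_sum I M -> N}),
    forall y : N, exists x : direct_sum I M, f x = y.

(* Main.v *)
Require Import Defs.
From HB Require Import structures.
From mathcomp Require Import all_boot all_algebra.
From mathcomp Require Import boolp classical_sets functions cardinality.

Set Implicit Arguments.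
Unset Strict Implicit.
Unset Printing Implicit Defensive.

Import GRing.Theory.
Local Open Scope ring_scope.

(** Idea. Since End(M) is abelian regular, every homomorphism M -> N factors
    through a retraction of M onto a fully invariant summand e M contained in N,
    with e a central idempotent, and finitely many such summands lie in a common
    one; as N is M-generated, it is the directed union of these summands. Every
    endomorphism g of N preserves each e M, on which it is the restriction of
    g e in End(M). Hence idempotents of End(N) are central, and N is the direct
    sum of ker g and im g, so that g is regular. *)

(** The hypotheses give im g = im g^2 and ker g = ker g^2, so N is the direct sum of ker g and im g;
    [h] vanishes on the first and inverts g on the second. *)
Lemma regular_of_ker_im (R : pzRingType) (N : lmodType R) (g : {linear N -> N}) :
    (forall n, exists w, g n = g (g w)) ->
    (forall n, g (g n) = 0 -> g n = 0) ->
  exists h : {linear N -> N}, forall n, g (h (g n)) = g n.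
Proof.
move=> im_g ker_g.
(* [h] is the group inverse of [g]: [h n] is the point of im g congruent, after
   applying g, to [n] modulo ker g. *)
pose is_inv n y := (exists w, y = g w) /\ g (g y) = g n.
have ex_inv n : exists y, is_inv n y.
  have [w gn] := im_g n; have [w' gw] := im_g w.
  by exists (g w'); split; [exists w' | rewrite gn gw].
have inv_uniq n y y' : is_inv n y -> is_inv n y' -> y = y'.
  move=> [[w ->] e] [[w' ->] e']; apply/eqP; rewrite -subr_eq0 -linearB.
  apply/eqP/ker_g/ker_g; rewrite !linearB; apply/eqP; rewrite subr_eq0.
  by rewrite e e'.
have [h hP] := choice ex_inv.
have h_lin : linear h.
  move=> a u v; apply: (@inv_uniq (a *: u + v)) => //.
  have [[[w hu] gu] [[w' hv] gv]] := (hP u, hP v).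
  split; first by exists (a *: w + w'); rewrite linearP hu hv.
  by rewrite !linearP gu gv.
pose hL := HB.pack_for {linear N -> N} h
  (GRing.isLinear.Build R N N *:%R h h_lin).
exists hL => n; apply/eqP; rewrite -subr_eq0 -linearB; apply/eqP/ker_g.
have [_] := hP (g n); rewrite linearB linearB /= => ->.
by rewrite subrr.
Qed.

Section DirectSumInjection.
Variables (R : pzRingType) (I : Type) (M : rmodType R) (i : I).

Definition single (m : M) : I -> M := fun j => if `[< j = i >] then m else 0.

Lemma single_finitely_supported m : finitely_supported (single m).
Proof.
apply/asboolP; apply: sub_finite_set (finite_set1 i) => j /=.
by rewrite /single; case: asboolP => // _ /eqP.
Qed.

Definition inj (m : M) : direct_sum I M :=
  exist (fun u => finitely_supported u) (single m) (single_finitely_supported m).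

Lemma inj_is_linear : linear inj.
Proof.
move=> a u v; apply: val_inj; rewrite linearP /=; apply/funext => j.
rewrite /GRing.add /= /GRing.scale /= /single.
by case: asboolP => // _; rewrite scaler0 addr0.
Qed.

HB.instance Definition _ :=
  GRing.isLinear.Build R^c M (direct_sum I M) *:%R inj inj_is_linear.

End DirectSumInjection.

(** Induction on a list covering the support: subtracting [inj i (val x i)] clears coordinate i. *)
Lemma direct_sum_ind (R : pzRingType) (I : Type) (M : rmodType R)
    (P : direct_sum I M -> Prop) :
    P 0 -> (forall u v, P u -> P v -> P (u + v)) ->
    (forall i m, P (inj i m)) -> forall x, P x.
Proof.
move=> P0 PD Pinj x.
have /asboolP/(@finite_seqP {classic I})[s sx] := valP x.
have {sx} : forall i : {classic I}, val x i != 0 -> i \in s.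
  by move=> i xi; have : [set` s]%classic i by rewrite -sx.
elim: s x => [|i s IHs] x xs.
  suff -> : x = 0 by [].
  by apply: val_inj; apply/funext => j; apply/eqP/negPn/negP => /xs.
rewrite -[x](subrK (inj i (val x i))); apply: PD => //; apply: IHs => j.
rewrite linearB /= /GRing.add /= /GRing.opp /= /single.
case: asboolP => [->|ji]; first by rewrite subrr eqxx.
by rewrite subr0 => /xs; rewrite inE => /orP[/eqP|].
Qed.

Section Submodule.
Variables (R : pzRingType) (M : rmodType R) (S : pred M) (N : subLmodType S).
Hypotheses (abM : abelian_ring (endo M)) (regM : von_neumann_regular (endo M)).

Let v : {linear N -> M} := (\val : N -> M).

Lemma endo_mulE (f g : endo M) m : (f * g : endo M) m = f (g m).
Proof. by []. Qed.

Lemma abelian_idem_comm (e s : endo M) :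
  (forall m, e (e m) = e m) -> forall m, e (s m) = s (e m).
Proof.
move=> ee m; have /abM/(_ s) : e * e = e by exact: linear_ext.
by move=> es; rewrite -!endo_mulE es.
Qed.

(** Equivalently, [v \o p] is an idempotent of End(M); its image lies in N. *)
Definition projection (p : {linear M -> N}) : Prop :=
  forall m, p (v (p m)) = p m.

Lemma projection_comm (p : {linear M -> N}) (s : endo M) :
  projection p -> forall m, v (p (s m)) = s (v (p m)).
Proof.
move=> pp; apply: (@abelian_idem_comm (v \o p : {linear M -> M})) => m /=.
by rewrite pp.
Qed.

(** The endomorphism [v \o g \o p] of M agrees with g at n and commutes with the central idempotent
    [v \o p]. *)
Lemma projection_fix_endo (p : {linear M -> N}) (g : endo N) n :
  projection p -> p (v n) = n -> p (v (g n)) = g n.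
Proof.
move=> pp pn; apply: val_inj.
have := projection_comm (v \o g \o p : {linear M -> M}) pp (v n).
by rewrite /= !pn.
Qed.

Definition locally_fixed (n : N) : Prop :=
  exists2 p : {linear M -> N}, projection p & p (v n) = n.

Lemma locally_fixed0 : locally_fixed 0.
Proof. by exists (\0 : {linear M -> N}). Qed.

Lemma locally_fixedD n1 n2 :
  locally_fixed n1 -> locally_fixed n2 -> locally_fixed (n1 + n2).
Proof.
move=> [p pp pn1] [q qq qn2].
(* The join e + f - e f of the commuting idempotents given by p and q: its image contains both of
   theirs. *)
pose r : {linear M -> N} := (p \+ q) \- (p \o v \o q).
have rE m : r m = p m + q m - p (v (q m)) by [].
have rp m : r (v (p m)) = p m.
  rewrite rE pp; have := projection_comm (v \o q : {linear M -> M}) pp (v (p m)).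
  by rewrite /= pp => /val_inj ->; rewrite addrK.
have rq m : r (v (q m)) = q m by rewrite rE qq addrAC subrr add0r.
have rvD x y : r (v (x + y)) = r (v x) + r (v y) by rewrite !raddfD.
have rvB x y : r (v (x - y)) = r (v x) - r (v y) by rewrite !raddfB.
exists r; last by rewrite rvD -[in LHS]pn1 -[in LHS]qn2 rp rq pn1 qn2.
move=> m; rewrite [r m]rE rvB rvD rp rq.
by rewrite rp.
Qed.

(** If x is a quasi-inverse of [v \o f] in End(M), then [f \o x] is a projection fixing the image of
    f. *)
Lemma locally_fixed_img (f : {linear M -> N}) m : locally_fixed (f m).
Proof.
have [x fxf] := regM (v \o f : {linear M -> M}).
have fE k : f (x (v (f k))) = f k.
  by apply: val_inj; move: (congr1 (fun h : endo M => h k) fxf).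
by exists (f \o x : {linear M -> N}) => [k|] /=; rewrite fE.
Qed.

Lemma generated_locally_fixed : generated_by M N -> forall n, locally_fixed n.
Proof.
move=> [I [f f_surj]] n; have [x <-] := f_surj n.
elim/direct_sum_ind: x => [|u w|i m]; first by rewrite linear0; exact: locally_fixed0.
  by rewrite linearD; exact: locally_fixedD.
exact: (@locally_fixed_img (f \o @inj R I M i : {linear M -> N})).
Qed.

Hypothesis fixN : forall n, locally_fixed n.

Lemma locally_fixed_abelian : abelian_ring (endo N).
Proof.
move=> e ee s; apply: linear_ext => n; have [p pp pn] := fixN n.
have eeE k : e (e k) = e k by move: (congr1 (fun h : endo N => h k) ee).
apply: val_inj.
have fixp (g : endo N) m : p (v (g (p m))) = g (p m).
  exact: projection_fix_endo (pp m).
have := @abelian_idem_comm (v \o e \o p : {linear M -> M})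
  (v \o s \o p : {linear M -> M}).
move=> /(_ _ (v n)); rewrite /= !fixp pn; apply=> m.
by rewrite fixp eeE.
Qed.

(** A quasi-inverse found in End(M) depends on p, hence on n. Instead of gluing these, the proof
    uses them to check the kernel and image conditions one element at a time. *)
Lemma locally_fixed_regular : von_neumann_regular (endo N).
Proof.
move=> g; suff [h ghg] : exists h : {linear N -> N}, forall n, g (h (g n)) = g n.
  by exists h; apply: linear_ext.
have fixp (p : {linear M -> N}) m : projection p -> p (v (g (p m))) = g (p m).
  by move=> pp; exact: projection_fix_endo (pp m).
(* In an abelian regular ring, a x a = a implies a a x = a = x a a. *)
apply: regular_of_ker_im => n; have [p pp pn] := fixN n;
  pose a : endo M := (v \o g \o p : {linear M -> M});
  have [x axa] := regM a;
  have {}axa m : a (x (a m)) = a m by move: (congr1 (fun h : endo M => h m) axa).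
(* Both a x and x a are idempotent, hence commute with a. *)
- have aax m : a (a (x m)) = a m.
    rewrite -[RHS]axa; symmetry; apply: (@abelian_idem_comm (a * x) a) => k.
    by rewrite !endo_mulE axa.
  (* Applying p brings x (v n) into N without changing its image under a. *)
  exists (p (x (v n))); apply: val_inj; move: (aax (v n)).
  by rewrite /= !fixp // pn.
- have xaa m : x (a (a m)) = a m.
    rewrite -[RHS]axa; apply: (@abelian_idem_comm (x * a) a) => k.
    by rewrite !endo_mulE axa.
  move=> ggn; apply: val_inj; move: (xaa (v n)).
  have -> : a (v n) = v (g n) by rewrite /= pn.
  have -> : a (v (g n)) = v (g (g n)) by rewrite /= projection_fix_endo.
  by rewrite ggn !raddf0.
Qed.

End Submodule.

Theorem theorem2p16 (R : pzRingType) (M : rmodType R)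
    (S : pred M) (N : subLmodType S) :
  abelian_endoregular M -> generated_by M N -> abelian_endoregular N.
Proof.
move=> [abM regM] /(generated_locally_fixed abM regM) fixN.
split; first exact: locally_fixed_abelian.
exact: locally_fixed_regular.
Qed.
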